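(* For every polynomial time computable function $f:\{0,1\}^*\to\{0,1\}^*$ there exists a $\lambda$-term $t_f$ such that $;\vdash t_f:\mathbf{W}_{\mathrm{Church}}\Rightarrow\mathbf{W}_{\mathrm{Scott}}$ is derivable in $\mathrm{DIAL}$, and for every $w\in\{0,1\}^*$ the $\beta$-normal form of $t_f\,\underline{w}$ is $\overline{f(w)}$.
   Context: $\lambda$-terms: $t::=x\mid\lambda x.t\mid tu$. The system $\mathrm{DIAL}$: linear formulas $L,M::=\alpha\mid\forall\alpha L\mid\mu\alpha L\mid L\multimap M$ (where $\mu\alpha L$ may be formed only if $\alpha$ occurs only positively in $L$); formulas $A,B::=L\mid\forall\alpha A\mid L\multimap B\mid A\Rightarrow B$. Judgments $\Gamma;\Delta\vdash t:A$ where $\Delta$ assigns linear formulas and $\Gamma$ arbitrary formulas to distinct variables. Rules: (ax1) $x:A;\vdash x:A$; (ax2) $;x:L\vdash x:L$; ($\mu_e$) from $\Gamma;\Delta\vdash t:\mu\alpha L$ infer $\Gamma;\Delta\vdash t:L[\mu\alpha L/\alpha]$; ($\mu_i$) the converse; ($\forall_i$) from $\Gamma;\Delta\vdash t:A$ with $\alpha$ not free in $\Gamma,\Delta$ infer $\Gamma;\Delta\vdash t:\forall\alpha A$; ($\forall_e$) from $\Gamma;\Delta\vdash t:\forall\alpha A$ infer $\Gamma;\Delta\vdash t:A[L/\alpha]$ for $L$ linear; ($\Rightarrow_e$) from $\Gamma_1;\Delta\vdash t:A\Rightarrow B$ and $\Gamma_2;\vdash u:A$ infer $\Gamma_1,\Gamma_2;\Delta\vdash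 tu:B$; ($\Rightarrow_i$) from $\Gamma,z:A;\Delta\vdash t:B$ infer $\Gamma;\Delta\vdash\lambda z.t:A\Rightarrow B$; ($\multimap_e$) from $\Gamma_1;\Delta_1\vdash t:L\multimap B$ and $\Gamma_2;\Delta_2\vdash u:L$ infer $\Gamma_1,\Gamma_2;\Delta_1,\Delta_2\vdash tu:B$; ($\multimap_i$) from $\Gamma;\Delta,z:L\vdash t:B$ infer $\Gamma;\Delta\vdash\lambda z.t:L\multimap B$; (Contr) from $\Gamma,x:A,y:A;\Delta\vdash t:B$ infer $\Gamma,z:A;\Delta\vdash t[z/x,z/y]:B$; (Derel) from $\Gamma;\Delta,x:L\vdash t:B$ infer $\Gamma,x:L;\Delta\vdash t:B$; (Weak) from $\Gamma;\Delta\vdash t:B$ infer $\Gamma,\Gamma';\Delta,\Delta'\vdash t:B$. $\mathbf{W}_{\mathrm{Church}}=\forall\alpha(\alpha\multimap\alpha)\Rightarrow(\alpha\multimap\alpha)\Rightarrow(\alpha\multimap\alpha)$, $\underline{w}=\lambda f_0f_1x.f_{i_1}(f_{i_2}(\cdots f_{i_n}(x)\cdots))$ for $w=i_1\cdots i_n$; $\mathbf{W}_{\mathrm{Scott}}=\mu\beta\forall\alpha(\beta\multimap\alpha)\multimap(\beta\multimap\alpha)\multimap(\alpha\multimap\alpha)$, $\overline{\epsilon}=\lambda xyz.z$, $\overline{0w}=\lambda xyz.x\,\overline{w}$, $\overline{1w}=\lambda xyz.y\,\overline{w}$. *)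

(* Defs.v *)
From HB Require Import structures.
From mathcomp Require Import all_boot.
From Stdlib Require Import Relation_Operators.

Set Implicit Arguments.
Unset Strict Implicit.
Unset Printing Implicit Defensive.

(** * Lambda-terms *)

(* Terms up to alpha-equivalence: variables are de Bruijn indices. *)
Inductive term : Type :=
| tvar of nat
| tlam of term
| tapp of term & term.

Definition up_ren (r : nat -> nat) (i : nat) : nat :=
  if i is j.+1 then (r j).+1 else 0.

Fixpoint tren (r : nat -> nat) (t : term) : term :=
  match t with
  | tvar i => tvar (r i)
  | tlam t => tlam (tren (up_ren r) t)
  | tapp t u => tapp (tren r t) (tren r u)
  end.

Definition tup (s : nat -> term) (i : nat) : term :=
  if i is j.+1 then tren succn (s j) else tvar 0.

Fixpoint tsubst (s : nat -> term) (t : term) : term :=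
  match t with
  | tvar i => s i
  | tlam t => tlam (tsubst (tup s) t)
  | tapp t u => tapp (tsubst s t) (tsubst s u)
  end.

(* [tinst u t] is [t] with index 0 replaced by [u] and the other free indices
   lowered by one. *)
Definition tinst (u : term) : term -> term :=
  tsubst (fun i => if i is j.+1 then tvar j else u).

Inductive beta : term -> term -> Prop :=
| beta_red t u : beta (tapp (tlam t) u) (tinst u t)
| beta_lam t t' : beta t t' -> beta (tlam t) (tlam t')
| beta_appl t t' u : beta t t' -> beta (tapp t u) (tapp t' u)
| beta_appr t u u' : beta u u' -> beta (tapp t u) (tapp t u').

Definition beta_normal (t : term) : Prop := forall u, ~ beta t u.

Definition beta_nf_of (t u : term) : Prop :=
  clos_refl_trans term beta t u /\ beta_normal u.

(** * Formulas of DIAL *)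

(* Raw formulas, with de Bruijn indices for type variables; the two syntactic
   classes are carved out by [is_lin] and [is_form].  A single raw syntax is
   used because linear formulas are literally formulas. *)
Inductive form : Type :=
| fvar of nat
| fall of form
| fmu of form
| flolli of form & form
| farr of form & form.

Lemma form_comparable : comparable form.
Proof. by move=> A B; rewrite /decidable; do 2?decide equality. Defined.

HB.instance Definition _ := hasDecEq.Build form (compareP form_comparable).

Fixpoint fren (r : nat -> nat) (A : form) : form :=
  match A with
  | fvar i => fvar (r i)
  | fall A => fall (fren (up_ren r) A)
  | fmu A => fmu (fren (up_ren r) A)
  | flolli A B => flolli (fren r A) (fren r B)
  | farr A B => farr (fren r A) (fren r B)
  end.

Definition fup (s : nat -> form) (i : nat) : form :=
  if i is j.+1 then fren succn (s j) else fvar 0.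

Fixpoint fsubst (s : nat -> form) (A : form) : form :=
  match A with
  | fvar i => s i
  | fall A => fall (fsubst (fup s) A)
  | fmu A => fmu (fsubst (fup s) A)
  | flolli A B => flolli (fsubst s A) (fsubst s B)
  | farr A B => farr (fsubst s A) (fsubst s B)
  end.

Definition finst (L : form) : form -> form :=
  fsubst (fun i => if i is j.+1 then fvar j else L).

(* All free occurrences of variable [k] in [A] are positive ([p = true]),
   resp. negative ([p = false]). *)
Fixpoint occurs_only (p : bool) (k : nat) (A : form) : bool :=
  match A with
  | fvar i => (i == k) ==> p
  | fall A => occurs_only p k.+1 A
  | fmu A => occurs_only p k.+1 A
  | flolli A B => occurs_only (~~ p) k A && occurs_only p k B
  | farr A B => occurs_only (~~ p) k A && occurs_only p k B
  end.

(* L, M ::= a | forall a L | mu a L (a only positive in L) | L -o M *)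
Fixpoint is_lin (A : form) : bool :=
  match A with
  | fvar _ => true
  | fall A => is_lin A
  | fmu A => is_lin A && occurs_only true 0 A
  | flolli A B => is_lin A && is_lin B
  | farr _ _ => false
  end.

(* A, B ::= L | forall a A | L -o B | A => B *)
Fixpoint is_form (A : form) : bool :=
  match A with
  | fall B => is_form B
  | flolli L B => is_lin L && is_form B
  | farr B C => is_form B && is_form C
  | _ => is_lin A
  end.

(** * Typing *)

(* A context lists the pairs (free variable, formula); the order is immaterial
   (rule [ty_exch]), and the conditions on [dom] below keep the variables of
   the two contexts of a derivable judgment pairwise distinct. *)
Definition ctx := seq (nat * form).

Definition dom (C : ctx) : seq nat := [seq p.1 | p <- C].

Definition codom_all (P : pred form) (C : ctx) : bool := all (fun p => P p.2) C.

(* Passing under a lambda: the variables outside are shifted, so that 0 is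
   the fresh bound variable. *)
Definition under_lam (C : ctx) : ctx := [seq (p.1.+1, p.2) | p <- C].

(* Passing under a forall: type variable 0 is not free in [under_all C]. *)
Definition under_all (C : ctx) : ctx := [seq (p.1, fren succn p.2) | p <- C].

(* The renaming [z/x, z/y]. *)
Definition merge_vars (x y z : nat) (i : nat) : nat :=
  if (i == x) || (i == y) then z else i.

(* [dial G D t A] is the judgment G; D |- t : A.  Well-formedness is required
   wherever a rule introduces a new formula, so that in a derivable judgment
   [D] consists of linear formulas and [G], [A] of formulas. *)
Inductive dial : ctx -> ctx -> term -> form -> Prop :=
| ty_ax1 x A : is_form A ->
    dial [:: (x, A)] [::] (tvar x) A
| ty_ax2 x L : is_lin L ->
    dial [::] [:: (x, L)] (tvar x) L
| ty_mu_e G D t L :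
    dial G D t (fmu L) ->
    dial G D t (finst (fmu L) L)
| ty_mu_i G D t L : is_lin (fmu L) ->
    dial G D t (finst (fmu L) L) ->
    dial G D t (fmu L)
| ty_all_i G D t A :
    dial (under_all G) (under_all D) t A ->
    dial G D t (fall A)
| ty_all_e G D t A L : is_lin L ->
    dial G D t (fall A) ->
    dial G D t (finst L A)
| ty_arr_e G1 G2 D t u A B : uniq (dom (G1 ++ G2 ++ D)) ->
    dial G1 D t (farr A B) ->
    dial G2 [::] u A ->
    dial (G1 ++ G2) D (tapp t u) B
| ty_arr_i G D t A B :
    dial ((0, A) :: under_lam G) (under_lam D) t B ->
    dial G D (tlam t) (farr A B)
| ty_lolli_e G1 G2 D1 D2 t u L B : uniq (dom (G1 ++ G2 ++ D1 ++ D2)) ->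
    dial G1 D1 t (flolli L B) ->
    dial G2 D2 u L ->
    dial (G1 ++ G2) (D1 ++ D2) (tapp t u) B
| ty_lolli_i G D t L B :
    dial (under_lam G) ((0, L) :: under_lam D) t B ->
    dial G D (tlam t) (flolli L B)
| ty_contr G D t x y z A B : z \notin dom (G ++ D) ->
    dial ((x, A) :: (y, A) :: G) D t B ->
    dial ((z, A) :: G) D (tren (merge_vars x y z) t) B
| ty_derel G D t x L B :
    dial G ((x, L) :: D) t B ->
    dial ((x, L) :: G) D t B
| ty_weak G G' D D' t B :
    codom_all is_form G' -> codom_all is_lin D' ->
    uniq (dom (G ++ G' ++ D ++ D')) ->
    dial G D t B ->
    dial (G ++ G') (D ++ D') t B
| ty_exch G G' D D' t B : perm_eq G G' -> perm_eq D D' ->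
    dial G D t B ->
    dial G' D' t B.

(** * Binary words: [false] is the letter 0 and [true] the letter 1 *)

(* forall a. (a -o a) => (a -o a) => (a -o a) *)
Definition W_Church : form :=
  let aa := flolli (fvar 0) (fvar 0) in fall (farr aa (farr aa aa)).

(* mu b. forall a. (b -o a) -o (b -o a) -o (a -o a) *)
Definition W_Scott : form :=
  let ba := flolli (fvar 1) (fvar 0) in
  fmu (fall (flolli ba (flolli ba (flolli (fvar 0) (fvar 0))))).

(* Under the three lambdas f0, f1, x are the indices 2, 1, 0. *)
Definition church (w : seq bool) : term :=
  tlam (tlam (tlam
    (foldr (fun b t => tapp (tvar (if b then 1 else 2)) t) (tvar 0) w))).

(* Under the three lambdas x, y, z are the indices 2, 1, 0; the inner word is
   a closed term, so it needs no shift. *)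
Fixpoint scott (w : seq bool) : term :=
  match w with
  | [::] => tlam (tlam (tlam (tvar 0)))
  | b :: w' => tlam (tlam (tlam (tapp (tvar (if b then 1 else 2)) (scott w'))))
  end.

(** * Polynomial time *)

Inductive symbol (K : Type) : Type :=
| Blank
| Bit of bool
| Aux of K.
Arguments Blank {K}.
Arguments Bit {K}.

Inductive move : Type := MoveL | Stay | MoveR.

(* Deterministic one-tape Turing machines, with a finite set [tm_aux] of
   auxiliary tape symbols; the machine halts when [tm_trans] is [None]. *)
Record turing : Type := Turing {
  tm_state : finType;
  tm_aux : finType;
  tm_start : tm_state;
  tm_trans : tm_state -> symbol tm_aux ->
             option (tm_state * symbol tm_aux * move)
}.

(* The tape is infinite in both directions: [cf_left] lists the cells left of
   the head, nearest first, [cf_right] the scanned cell and those to its right;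
   all the cells not listed are blank. *)
Record config (M : turing) : Type := Config {
  cf_state : tm_state M;
  cf_left : seq (symbol (tm_aux M));
  cf_right : seq (symbol (tm_aux M))
}.

Definition tm_init (M : turing) (w : seq bool) : config M :=
  Config (tm_start M) [::] [seq Bit b | b <- w].

Definition tm_step (M : turing) (c : config M) : option (config M) :=
  let: Config q l r := c in
  if tm_trans q (head Blank r) is Some (q', a, d) then
    let r' := behead r in
    Some match d with
         | MoveL => Config q' (behead l) (head Blank l :: a :: r')
         | Stay => Config q' l (a :: r')
         | MoveR => Config q' (a :: l) r'
         end
  else None.

Fixpoint read_bits (K : Type) (s : seq (symbol K)) : seq bool :=
  if s is Bit b :: s' then b :: read_bits s' else [::].

(* The output is the block of bits that starts at the head and extends to the
   right up to the first cell that does not hold a bit. *)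
Fixpoint tm_halts_within (M : turing) (n : nat) (c : config M) (u : seq bool) :
    Prop :=
  match tm_step c, n with
  | None, _ => read_bits (cf_right c) = u
  | Some c', n'.+1 => tm_halts_within n' c' u
  | Some _, 0 => False
  end.

Definition polytime (f : seq bool -> seq bool) : Prop :=
  exists (M : turing) (c k : nat), forall w : seq bool,
    tm_halts_within (c * size w ^ k + c) (tm_init M w) (f w).

(* Main.v *)
(** All data are Scott-encoded by linear formulas: tape symbols and states by
    numbers, the two halves of the tape by lists, and a configuration by a
    triple.  A case analysis is an affine use of its argument, so one machine
    step is a closed term of type [C -o C]; reading off the output is a closed
    term of type [(List -o W) -o (List -o W)], which adds one level of recursion
    depth.  A closed term [F : L -o L] is iterated [|w|] times by [w F F], which
    is again of type [L -o L] and uses no linear variable; nesting this [k]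
    times, over [F] composed [d] times with itself, gives [d * |w| ^ k]
    iterations.  The only nonlinear variable is [w], so contraction is needed
    only for terms of the form [fun w => (t w) (u w)] with [t] and [u] closed. *)

Require Import Defs.
From mathcomp Require Import all_boot.
From mathcomp Require Import zify.
From Stdlib Require Import Relation_Operators.

Set Implicit Arguments.
Unset Strict Implicit.
Unset Printing Implicit Defensive.

Local Notation "t \@ u" := (tapp t u) (at level 25, left associativity).
Local Notation "A -o B" := (flolli A B) (at level 60, right associativity).
Local Notation red := (clos_refl_trans term beta).

(** * Closed terms *)

Fixpoint closedn (k : nat) (t : term) : bool :=
  match t with
  | tvar i => i < k
  | tlam t => closedn k.+1 t
  | tapp t u => closedn k t && closedn k u
  end.

Notation closed := (closedn 0).

Fixpoint occ (i : nat) (t : term) : bool :=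
  match t with
  | tvar j => j == i
  | tlam t => occ i.+1 t
  | tapp t u => occ i t || occ i u
  end.

Lemma tren_closedn k t r :
  closedn k t -> (forall i, i < k -> r i = i) -> tren r t = t.
Proof.
elim: t k r => [i|t IH|t IHt u IHu] k r /= => [ki rk|kt rk|/andP[kt ku] rk].
- by rewrite rk.
- by rewrite (IH k.+1) // => -[|i] //= ik; rewrite rk.
- by rewrite (IHt k) // (IHu k).
Qed.

Lemma tsubst_closedn k t s :
  closedn k t -> (forall i, i < k -> s i = tvar i) -> tsubst s t = t.
Proof.
elim: t k s => [i|t IH|t IHt u IHu] k s /= => [ki sk|kt sk|/andP[kt ku] sk].
- by rewrite sk.
- by rewrite (IH k.+1) // => -[|i] //= ik; rewrite sk.
- by rewrite (IHt k) // (IHu k).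
Qed.

Lemma occ_closedn k i t : closedn k t -> k <= i -> occ i t = false.
Proof.
elim: t k i => [j|t IH|t IHt u IHu] k i /= => [jk ki|kt ki|/andP[kt ku] ki].
- by rewrite ltn_eqF // (leq_trans jk).
- exact: IH kt _.
- by rewrite (IHt k) // (IHu k).
Qed.

Lemma closedn_le k m t : closedn k t -> k <= m -> closedn m t.
Proof.
elim: t k m => [j|t IH|t IHt u IHu] k m /= => [jk km|kt km|/andP[kt ku] km].
- exact: leq_trans jk km.
- exact: IH kt _.
- by rewrite (IHt k) // (IHu k).
Qed.

Lemma tren_closed r t : closed t -> tren r t = t.
Proof. by move=> ct; apply: tren_closedn ct _. Qed.

Lemma tsubst_closed s t : closed t -> tsubst s t = t.
Proof. by move=> ct; apply: tsubst_closedn ct _. Qed.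

Lemma occ_closed i t : closed t -> occ i t = false.
Proof. by move=> ct; apply: occ_closedn ct _. Qed.

Lemma closed_closedn k t : closed t -> closedn k.+1 t.
Proof. by move=> ct; apply: closedn_le ct _. Qed.

Lemma closed_app t u : closed t -> closed u -> closed (t \@ u).
Proof. by move=> ct cu; rewrite /= ct. Qed.

Lemma closed_iter_app n f x : closed f -> closed x -> closed (iter n (tapp f) x).
Proof. by move=> cf cx; elim: n => //= n ->; rewrite cf. Qed.

(** * Reduction *)

Lemma red_trans t u v : red t u -> red u v -> red t v.
Proof. exact: rt_trans. Qed.

Lemma red_appl t t' u : red t t' -> red (t \@ u) (t' \@ u).
Proof.
elim=> [a b ab|a|a b c _ ab _ bc]; [|exact: rt_refl|exact: red_trans ab bc].
exact/rt_step/beta_appl.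
Qed.

Lemma red_appr t u u' : red u u' -> red (t \@ u) (t \@ u').
Proof.
elim=> [a b ab|a|a b c _ ab _ bc]; [|exact: rt_refl|exact: red_trans ab bc].
exact/rt_step/beta_appr.
Qed.

Lemma red_app t t' u u' : red t t' -> red u u' -> red (t \@ u) (t' \@ u').
Proof. by move=> /red_appl tt' /red_appr uu'; apply: red_trans (tt' _) (uu' _). Qed.

(** Weak head reduction as a function, so that reductions of concrete terms are carried out by
    computation. It is the identity when the spine does not start with a redex. *)
Fixpoint head_step (t : term) : term :=
  match t with
  | tapp (tlam t) u => tinst u t
  | tapp t u => head_step t \@ u
  | _ => t
  end.

Lemma red_head_step t : red t (head_step t).
Proof.
elim: t => [i|t _|t IH u _]; [exact: rt_refl..|].
case: t IH => [i|t|t t'] IH /=; [exact: rt_refl| |exact: red_appl].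
exact/rt_step/beta_red.
Qed.

(** Only closed terms are substituted in these reductions, so the renamings and substitutions left
    on them are erased by their closedness. *)
Ltac hstep :=
  refine (red_trans (red_head_step _) _);
  rewrite /= /tinst /= ?(tren_closed, tsubst_closed) //=.

Lemma scott_closed w : closed (scott w).
Proof. by elim: w => //= -[] w; apply: closed_closedn. Qed.

(** Under the three abstractions the only application has a variable as its head, so a redex could
    lie only in the encoded tail. *)
Lemma scott_normal w : beta_normal (scott w).
Proof.
have lamN t : beta_normal t -> beta_normal (tlam t).
  by move=> nt u tu; inversion tu; subst; apply: nt H0.
elim: w => [|b w IH] /=; do 3 apply: (lamN); first by move=> u xu; inversion xu.
move=> u xu; inversion xu; subst; first by inversion H2.
exact: IH H2.
Qed.

(** * Affine typing *)

(* The linear context of [t] in the de Bruijn environment [E] keeps the free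
   variables of [t] only, which makes the splitting of contexts automatic. *)
Fixpoint ctx_of (k : nat) (E : seq form) (t : term) : ctx :=
  if E is L :: E' then
    if occ k t then (k, L) :: ctx_of k.+1 E' t else ctx_of k.+1 E' t
  else [::].

Definition aff (E : seq form) (t : term) (A : form) : Prop :=
  dial [::] (ctx_of 0 E t) t A.

Lemma ctx_of_closed k E t : closed t -> ctx_of k E t = [::].
Proof. by move=> ct; elim: E k => //= L E IH k; rewrite occ_closed. Qed.

Lemma ctx_of_lam k E t : under_lam (ctx_of k E (tlam t)) = ctx_of k.+1 E t.
Proof. by elim: E k => //= L E IH k; case: ifP => _ /=; rewrite IH. Qed.

Lemma ctx_of_all k E t :
  under_all (ctx_of k E t) = ctx_of k (map (fren succn) E) t.
Proof. by elim: E k => //= L E IH k; case: ifP => _ /=; rewrite IH. Qed.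

Lemma dom_ctx_of k E t i : i \in dom (ctx_of k E t) -> (k <= i) && occ i t.
Proof.
elim: E k => //= L E IH k; case: ifP => [ok|_].
  rewrite inE => /predU1P[->|/IH/andP[/ltnW-> //]]; by rewrite leqnn.
by move=> /IH/andP[/ltnW-> ->].
Qed.

Lemma uniq_ctx_of k E t : uniq (dom (ctx_of k E t)).
Proof.
elim: E k => //= L E IH k; case: ifP => //= _; rewrite IH andbT.
by apply/negP => /dom_ctx_of; rewrite ltnn.
Qed.

Definition disj (n : nat) (t u : term) : bool :=
  all (fun i => ~~ (occ i t && occ i u)) (iota 0 n).

(** Each context lists only the free variables of its own term, so under disjointness every index
    comes from one side only. This turns the split demanded by [ty_lolli_e] into a decidable
    check. *)
Lemma perm_ctx_of_app k E t u :
    all (fun i => ~~ (occ i t && occ i u)) (iota k (size E)) ->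
  perm_eq (ctx_of k E t ++ ctx_of k E u) (ctx_of k E (t \@ u)).
Proof.
elim: E k => //= L E IH k /andP[nk /IH pE].
case: (occ k t) nk => /= [/negPf->|_]; first by rewrite perm_cons.
case: (occ k u) => //.
by rewrite perm_catC /= perm_cons perm_catC.
Qed.

Lemma aff_app E t u L B :
  aff E t (L -o B) -> aff E u L -> disj (size E) t u -> aff E (t \@ u) B.
Proof.
move=> tA uA dtu; have pE := perm_ctx_of_app dtu.
apply: (ty_exch (perm_refl _) pE).
apply: (ty_lolli_e (G1 := [::]) (G2 := [::]) _ tA uA) => /=.
by rewrite (perm_uniq (perm_map _ pE)) uniq_ctx_of.
Qed.

Lemma aff_lam E t L B : is_lin L -> aff (L :: E) t B -> aff E (tlam t) (L -o B).
Proof.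
move=> linL; rewrite /aff /= -ctx_of_lam => tB; apply: ty_lolli_i.
case: ifP tB => // o0 tB.
(* Here the bound variable does not occur in the body: weakening appends its hypothesis at the end
   and exchange moves it to the front. *)
apply: (ty_exch (perm_refl _) (D := under_lam (ctx_of 0 E (tlam t)) ++ [:: (0, L)])).
  by rewrite perm_catC.
apply: (ty_weak (G := [::]) (G' := [::])) => //=; first by rewrite linL.
rewrite /dom map_cat cat_uniq /= orbF andbT ctx_of_lam uniq_ctx_of /=.
by apply/negP => /dom_ctx_of.
Qed.

Lemma ctx_of_var_lt k i E : i < k -> ctx_of k E (tvar i) = [::].
Proof.
by elim: E k => //= L E IH k ik; rewrite ltn_eqF // IH // ltnW.
Qed.

Lemma ctx_of_var k i E :
  i < size E -> ctx_of k E (tvar (k + i)) = [:: (k + i, nth (fvar 0) E i)].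
Proof.
elim: E k i => //= L E IH k [|i] iE /=; first by rewrite addn0 eqxx ctx_of_var_lt.
by rewrite -[X in _ == X]addn0 eqn_add2l /= addnS -addSn IH.
Qed.

Lemma aff_var E i A :
  nth (fvar 0) E i = A -> i < size E -> is_lin A -> aff E (tvar i) A.
Proof. by move=> <- iE lE; rewrite /aff (ctx_of_var 0 iE); apply: ty_ax2. Qed.

Lemma aff_all_i E t A : aff (map (fren succn) E) t A -> aff E t (fall A).
Proof. by move=> tA; apply: ty_all_i; rewrite ctx_of_all. Qed.

Lemma aff_all_e E t A L : is_lin L -> aff E t (fall A) -> aff E t (finst L A).
Proof. exact: ty_all_e. Qed.

Lemma aff_mu_i E t L :
  is_lin (fmu L) -> aff E t (finst (fmu L) L) -> aff E t (fmu L).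
Proof. exact: ty_mu_i. Qed.

Lemma aff_mu_e E t L : aff E t (fmu L) -> aff E t (finst (fmu L) L).
Proof. exact: ty_mu_e. Qed.

Definition ctyped (t : term) (A : form) : Prop := closed t /\ dial [::] [::] t A.

Lemma aff_ctyped E t A : ctyped t A -> aff E t A.
Proof. by case=> ct tA; rewrite /aff ctx_of_closed. Qed.

Lemma ctypedI t A : closed t -> aff [::] t A -> ctyped t A.
Proof. by []. Qed.

(** * Data types *)

Definition nat_form : form :=
  fmu (fall ((fvar 1 -o fvar 0) -o fvar 0 -o fvar 0)).

Definition list_form : form :=
  fmu (fall ((nat_form -o fvar 1 -o fvar 0) -o fvar 0 -o fvar 0)).

Definition config_form : form :=
  fall ((nat_form -o list_form -o list_form -o fvar 0) -o fvar 0).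

(** Case analysis is unfolding of [fmu] followed by instantiation of [fall] at the result type. The
    two branches may not share a linear variable; a variable that both need is abstracted in each
    branch and applied to the result of the case. *)
Lemma aff_nat_case E t u v X : is_lin X ->
    aff E t nat_form -> aff E u (nat_form -o X) -> aff E v X ->
    disj (size E) t u -> disj (size E) (t \@ u) v ->
  aff E (t \@ u \@ v) X.
Proof.
move=> linX tN uX vX dtu duv; apply: aff_app vX duv; apply: aff_app uX dtu.
exact: aff_all_e linX (aff_mu_e tN).
Qed.

Lemma aff_list_case E t u v X : is_lin X ->
    aff E t list_form -> aff E u (nat_form -o list_form -o X) -> aff E v X ->
    disj (size E) t u -> disj (size E) (t \@ u) v ->
  aff E (t \@ u \@ v) X.
Proof.
move=> linX tN uX vX dtu duv; apply: aff_app vX duv; apply: aff_app uX dtu.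
exact: aff_all_e linX (aff_mu_e tN).
Qed.

Lemma aff_config_case E t u X : is_lin X ->
    aff E t config_form ->
    aff E u (nat_form -o list_form -o list_form -o X) -> disj (size E) t u ->
  aff E (t \@ u) X.
Proof.
by move=> linX tN uX dtu; apply: aff_app uX dtu; apply: aff_all_e linX tN.
Qed.

Create HintDb ctyped.

(** Syntax-directed typing. The rules for [fmu] and [fall] leave no trace in the term, so they are
    applied by hand or through the case lemmas. *)
Ltac aff1 :=
  lazymatch goal with
  | |- aff _ (tlam _) (flolli _ _) => apply: aff_lam; [by []|]
  | |- aff _ (tvar _) _ => by apply: aff_var
  | |- aff _ (tapp _ _) _ => eapply aff_app
  | |- aff _ _ _ => eapply aff_ctyped; solve [eassumption | eauto 2 with ctyped]
  | |- is_true (disj _ _ _) => by rewrite /disj /= ?occ_closed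
  end.
Ltac affs := repeat aff1.

(** * Numerals and finite tables *)

Fixpoint enc_nat (n : nat) : term :=
  if n is m.+1 then tlam (tlam (tvar 1 \@ enc_nat m))
  else tlam (tlam (tvar 0)).

Lemma enc_nat_closed n : closed (enc_nat n).
Proof. by elim: n => //= n; apply: closed_closedn. Qed.
#[local] Hint Resolve enc_nat_closed : core.

Lemma enc_nat_ctyped n : ctyped (enc_nat n) nat_form.
Proof.
elim: n => [|n IH]; apply: ctypedI; rewrite ?enc_nat_closed //=.
  by apply: aff_mu_i => //; apply: aff_all_i; affs.
by apply: aff_mu_i => //; apply: aff_all_i; affs.
Qed.
#[local] Hint Resolve enc_nat_ctyped : ctyped.

(** A finite table compiled to nested case analyses: one successor is peeled off per entry, and [d]
    answers past the end of the table. *)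
Fixpoint nat_case (d : term) (bs : seq term) : term :=
  if bs is b :: bs' then tlam (tvar 0 \@ nat_case d bs' \@ b) else tlam d.

Lemma nat_case_closed d bs : closed d -> all closed bs -> closed (nat_case d bs).
Proof.
move=> cd; elim: bs => [|b bs IH] /=; first by move=> _; apply: closed_closedn.
by case/andP=> cb /IH cbs; rewrite !closed_closedn.
Qed.

Lemma nat_case_ctyped d bs X : is_lin X -> ctyped d X ->
  (forall i, i < size bs -> ctyped (nth d bs i) X) ->
  ctyped (nat_case d bs) (nat_form -o X).
Proof.
move=> linX dX; elim: bs => [|b bs IH] bX /=.
  by apply: ctypedI; [apply: closed_closedn; case: dX|affs].
have {}IH : ctyped (nat_case d bs) (nat_form -o X).
  by apply: IH => i ibs; apply: (bX i.+1).
have {}bX : ctyped b X by apply: (bX 0).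
have [[cb _] [cbs _]] := (bX, IH).
apply: ctypedI; first by rewrite /= !closed_closedn.
by aff1; apply: aff_nat_case => //; affs.
Qed.

Lemma nat_case_red d bs i : closed d -> all closed bs ->
  red (nat_case d bs \@ enc_nat i) (nth d bs i).
Proof.
move=> cd; elim: bs i => [|b bs IH] i /=.
  by move=> _; hstep; rewrite nth_nil; apply: rt_refl.
case/andP=> cb cbs; have cn := nat_case_closed cd cbs.
by case: i => [|i]; do 3 hstep; [apply: rt_refl|apply: IH].
Qed.

(** * Constructors of lists, configurations and output words *)

Definition nil_term : term := tlam (tlam (tvar 0)).
Definition cons_term : term :=
  tlam (tlam (tlam (tlam (tvar 1 \@ tvar 3 \@ tvar 2)))).
Definition config_term : term :=
  tlam (tlam (tlam (tlam (tvar 0 \@ tvar 3 \@ tvar 2 \@ tvar 1)))).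

Lemma nil_ctyped : ctyped nil_term list_form.
Proof.
rewrite /nil_term; apply: ctypedI => //; apply: aff_mu_i => //; apply: aff_all_i; affs.
Qed.
#[local] Hint Resolve nil_ctyped : ctyped.

Lemma cons_ctyped : ctyped cons_term (nat_form -o list_form -o list_form).
Proof.
rewrite /cons_term; apply: ctypedI => //; do 2 aff1.
by apply: aff_mu_i => //; apply: aff_all_i; affs.
Qed.
#[local] Hint Resolve cons_ctyped : ctyped.

Lemma config_ctyped :
  ctyped config_term (nat_form -o list_form -o list_form -o config_form).
Proof.
by rewrite /config_term; apply: ctypedI => //; do 3 aff1; apply: aff_all_i; affs.
Qed.
#[local] Hint Resolve config_ctyped : ctyped.

Definition nilW_term : term := tlam (tlam (tlam (tvar 0))).
Definition consW_term (b : bool) : term :=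
  tlam (tlam (tlam (tlam (tvar (if b then 1 else 2) \@ tvar 3)))).

Lemma nilW_ctyped : ctyped nilW_term W_Scott.
Proof.
rewrite /nilW_term; apply: ctypedI => //; apply: aff_mu_i => //; apply: aff_all_i; affs.
Qed.
#[local] Hint Resolve nilW_ctyped : ctyped.

Lemma consW_ctyped b : ctyped (consW_term b) (W_Scott -o W_Scott).
Proof.
case: b; (rewrite /consW_term; apply: ctypedI => //; aff1);
  by apply: aff_mu_i => //; apply: aff_all_i; affs.
Qed.
#[local] Hint Resolve consW_ctyped : ctyped.

Lemma consW_red b w : red (consW_term b \@ scott w) (scott (b :: w)).
Proof. by have cw := scott_closed w; hstep; case: b; apply: rt_refl. Qed.

(** * Simulation of a machine *)

Section Machine.

Variable M : turing.
Local Notation sym := (symbol (tm_aux M)).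

Definition state_code (q : tm_state M) : nat := index q (enum (tm_state M)).
(** The bits have codes 1 and 2 for every machine, which makes [input_term] independent of the
    machine. *)
Definition sym_code (a : sym) : nat :=
  match a with
  | Blank => 0
  | Bit false => 1
  | Bit true => 2
  | Aux k => (index k (enum (tm_aux M))).+3
  end.

Notation enc_state q := (enc_nat (state_code q)).
Notation enc_sym a := (enc_nat (sym_code a)).

Definition state_case (g : tm_state M -> term) : term :=
  nat_case (g (tm_start M)) [seq g q | q <- enum (tm_state M)].

(** Locked so that the simplifications in [hstep] do not unfold the first entries of the table. *)
Definition sym_case (g : sym -> term) : term :=
  locked (nat_case (g Blank)
    [:: g Blank, g (Bit false), g (Bit true)
      & [seq g (Aux k) | k <- enum (tm_aux M)]]).

Lemma state_case_closed g : (forall q, closed (g q)) -> closed (state_case g).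
Proof.
move=> cg; apply: nat_case_closed => //.
by rewrite all_map; apply/allP => q _ /=.
Qed.

Lemma sym_case_closed g : (forall a, closed (g a)) -> closed (sym_case g).
Proof.
rewrite /sym_case -lock => cg; apply: nat_case_closed => //=; rewrite !cg /=.
by rewrite all_map; apply/allP => q _ /=.
Qed.

Lemma state_case_ctyped g X : is_lin X -> (forall q, ctyped (g q) X) ->
  ctyped (state_case g) (nat_form -o X).
Proof.
move=> linX gX; apply: nat_case_ctyped => // i; rewrite size_map => iQ.
by rewrite (nth_map (tm_start M)).
Qed.

Lemma sym_case_ctyped g X : is_lin X -> (forall a, ctyped (g a) X) ->
  ctyped (sym_case g) (nat_form -o X).
Proof.
rewrite /sym_case -lock => linX gX; apply: nat_case_ctyped => // -[|[|[|i]]] //=.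
rewrite !ltnS size_map; case: (enum (tm_aux M)) => // k0 ks iK.
by rewrite (nth_map k0).
Qed.

Lemma state_case_red g q : (forall q, closed (g q)) ->
  red (state_case g \@ enc_state q) (g q).
Proof.
move=> cg; have qQ : q \in enum (tm_state M) by rewrite mem_enum.
rewrite -[X in red _ (g X)](nth_index (tm_start M) qQ).
rewrite -(nth_map _ (g (tm_start M))) ?index_mem //.
by apply: nat_case_red => //; rewrite all_map; apply/allP => ? _ /=.
Qed.

Lemma sym_case_red g a : (forall a, closed (g a)) ->
  red (sym_case g \@ enc_sym a) (g a).
Proof.
rewrite /sym_case -lock => cg; set ks := enum (tm_aux M).
have -> : g a = nth (g Blank)
    [:: g Blank, g (Bit false), g (Bit true) & [seq g (Aux k) | k <- ks]]
    (sym_code a).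
  case: a => [|[]|k] //=; have kK : k \in ks by rewrite mem_enum.
  by rewrite (nth_map k) ?index_mem // nth_index.
apply: nat_case_red => //=; rewrite !cg /=.
by rewrite all_map; apply/allP => ? _ /=.
Qed.

(** * Encoded configurations and one machine step *)

Fixpoint enc_list (s : seq sym) : term :=
  if s is a :: s' then tlam (tlam (tvar 1 \@ enc_sym a \@ enc_list s'))
  else nil_term.

Definition enc_config (c : config M) : term :=
  tlam (tvar 0 \@ enc_state (cf_state c) \@ enc_list (cf_left c)
          \@ enc_list (cf_right c)).

Lemma enc_list_closed s : closed (enc_list s).
Proof. by elim: s => //= a s IH; rewrite !closed_closedn. Qed.
#[local] Hint Resolve enc_list_closed : core.

Lemma enc_config_closed c : closed (enc_config c).
Proof. by rewrite /= !closed_closedn. Qed.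
#[local] Hint Resolve enc_config_closed : core.

Lemma cons_red a s : red (cons_term \@ enc_sym a \@ enc_list s) (enc_list (a :: s)).
Proof. by do 2 hstep; apply: rt_refl. Qed.

Lemma config_red q l r :
  red (config_term \@ enc_state q \@ enc_list l \@ enc_list r)
      (enc_config (Config q l r)).
Proof. by do 3 hstep; apply: rt_refl. Qed.

(** The arguments are the left half and the right half beyond the scanned cell. A left move inspects
    the left half; both outcomes need the right half, so each branch abstracts it and it is applied
    after the case. *)
Definition act_term (q : tm_state M) (a : sym) : term :=
  match tm_trans q a with
  | None => tlam (tlam (config_term \@ enc_state q \@ tvar 1
                          \@ (cons_term \@ enc_sym a \@ tvar 0)))
  | Some (q', b, Stay) => tlam (tlam (config_term \@ enc_state q' \@ tvar 1
                          \@ (cons_term \@ enc_sym b \@ tvar 0)))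
  | Some (q', b, MoveR) => tlam (tlam (config_term \@ enc_state q'
                          \@ (cons_term \@ enc_sym b \@ tvar 1) \@ tvar 0))
  | Some (q', b, MoveL) =>
      tlam (tlam (tvar 1
        \@ tlam (tlam (tlam (config_term \@ enc_state q' \@ tvar 1
             \@ (cons_term \@ tvar 2 \@ (cons_term \@ enc_sym b \@ tvar 0)))))
        \@ tlam (config_term \@ enc_state q' \@ nil_term
             \@ (cons_term \@ enc_sym Blank \@ (cons_term \@ enc_sym b \@ tvar 0)))
        \@ tvar 0))
  end.

(* Unlike [tm_step], a halted machine keeps its configuration, up to an
   explicit blank under the head. *)
Definition total_step (c : config M) : config M :=
  if tm_step c is Some c' then c'
  else let: Config q l r := c in Config q l (head Blank r :: behead r).

Lemma act_closed q a : closed (act_term q a).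
Proof.
rewrite /act_term.
by case: tm_trans => [[[q' b] []]|]; rewrite /= !closed_closedn.
Qed.
#[local] Hint Resolve act_closed : core.

Lemma act_ctyped q a : ctyped (act_term q a) (list_form -o list_form -o config_form).
Proof.
apply: ctypedI; first exact: act_closed.
rewrite /act_term; case: tm_trans => [[[q' b] []]|]; [do 2 aff1|by affs..].
(* The right half is split off first, so that the case analysis is typed with result
   [list_form -o config_form]. *)
eapply aff_app; [|by affs..].
by apply: aff_list_case; affs.
Qed.

Lemma act_red q l r :
  red (act_term q (head Blank r) \@ enc_list l \@ enc_list (behead r))
      (enc_config (total_step (Config q l r))).
Proof.
have mk q' l' s s' : red s (enc_list s') ->
    red (config_term \@ enc_state q' \@ enc_list l' \@ s)
        (enc_config (Config q' l' s')).
  by move=> ss'; apply: red_trans (red_appr _ ss') (config_red _ _ _).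
have cons a s s' : red s (enc_list s') ->
    red (cons_term \@ enc_sym a \@ s) (enc_list (a :: s')).
  by move=> ss'; apply: red_trans (red_appr _ ss') (cons_red _ _).
rewrite /total_step /= /act_term.
case: tm_trans => [[[q' b] []]|]; do 2 hstep.
(* Two steps select the branch. The empty branch then takes the right half; the other one takes the
   popped cell, the rest of the left half and the right half. *)
- case: l => [|a l]; [do 3 hstep|do 5 hstep].
    exact: (mk _ [::] _ _ (cons Blank _ _ (cons _ _ _ (rt_refl _ _ _)))).
  exact: (mk _ _ _ _ (cons _ _ _ (cons _ _ _ (rt_refl _ _ _)))).
- exact: (mk _ _ _ _ (cons _ _ _ (rt_refl _ _ _))).
- apply: red_trans (config_red q' (b :: l) (behead r)).
  exact/red_appl/red_appr/cons_red.
- exact: (mk _ _ _ _ (cons _ _ _ (rt_refl _ _ _))).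
Qed.

Definition trans_term : term := state_case (fun q => sym_case (act_term q)).

Lemma trans_closed : closed trans_term.
Proof. by apply: state_case_closed => q; apply: sym_case_closed. Qed.
#[local] Hint Resolve trans_closed : core.

Lemma trans_ctyped : ctyped trans_term
  (nat_form -o nat_form -o list_form -o list_form -o config_form).
Proof.
apply: state_case_ctyped => // q; apply: sym_case_ctyped => // a.
exact: act_ctyped.
Qed.
#[local] Hint Resolve trans_ctyped : ctyped.

Lemma trans_red q l r :
  red (trans_term \@ enc_state q \@ enc_sym (head Blank r)
         \@ enc_list l \@ enc_list (behead r))
      (enc_config (total_step (Config q l r))).
Proof.
apply: red_trans (act_red q l r); do 2 apply: red_appl.
have sc q' : closed (sym_case (act_term q')) by apply: sym_case_closed.
by apply: red_trans (red_appl _ (state_case_red _ _)) (sym_case_red _ _).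
Qed.

(** The state and the left half are needed by both branches on the right half, so they too are
    applied after the case. An empty right half counts as a scanned blank. *)
Definition step_term : term :=
  tlam (tvar 0
    \@ tlam (tlam (tlam (tvar 0
         \@ tlam (tlam (tlam (tlam
              (trans_term \@ tvar 1 \@ tvar 3 \@ tvar 0 \@ tvar 2))))
         \@ tlam (tlam (trans_term \@ tvar 1 \@ enc_sym Blank \@ tvar 0
              \@ nil_term))
         \@ tvar 2 \@ tvar 1)))).

Lemma step_closed : closed step_term.
Proof. by rewrite /= !closed_closedn. Qed.
#[local] Hint Resolve step_closed : core.

Lemma step_ctyped : ctyped step_term (config_form -o config_form).
Proof.
apply: ctypedI; first exact: step_closed.
rewrite /step_term; aff1; apply: aff_config_case; [by []|by affs| |by affs].
do 3 aff1; eapply aff_app; [|by affs..]; eapply aff_app; [|by affs..].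
by apply: aff_list_case; affs.
Qed.

Lemma step_red c :
  red (step_term \@ enc_config c) (enc_config (total_step c)).
Proof.
case: c => q l r; apply: red_trans (trans_red q l r).
rewrite /step_term /enc_config /=; do 5 hstep.
by case: r => [|a r]; [do 4 hstep|do 6 hstep]; apply: rt_refl.
Qed.

(** * Runs of the machine and growth of the tape *)

Lemma iter_step_red n c :
  red (iter n (tapp step_term) (enc_config c))
      (enc_config (iter n total_step c)).
Proof.
elim: n => [|n IH] /=; first exact: rt_refl.
exact: red_trans (red_appr _ IH) (step_red _).
Qed.

(** A halted machine stays halted under [total_step], and a blank made explicit ends the block of
    bits just as the end of the list does. Running longer than the halting time therefore keeps the
    output. *)
Lemma iter_total_step_halts n m c u : tm_halts_within n c u -> n <= m ->
  read_bits (cf_right (iter m total_step c)) = u.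
Proof.
have idle c' : tm_step c' = None -> tm_step (total_step c') = None /\
    read_bits (cf_right (total_step c')) = read_bits (cf_right c').
  rewrite /total_step => cN; rewrite cN; by case: c' cN => q l [|a r].
elim: m n c => [|m IH] n c; first by case: n => //=; case: tm_step.
rewrite iterSr; case E: (tm_step c) => [c'|].
  by case: n => [|n] /=; rewrite /total_step E //; apply: IH.
(* The machine has halted already, so the induction hypothesis is used with time bound 0. *)
have [EN rE] := idle _ E => hc _; apply: (IH 0) => //=; rewrite EN rE.
by case: n hc => /=; rewrite E.
Qed.

(** The constant 2 is attained by a left move on an empty right half, where the scanned cell and its
    left neighbour both become explicit. *)
Lemma size_right_total_step c :
  size (cf_right (total_step c)) <= size (cf_right c) + 2.
Proof.
case: c => q l r; rewrite /total_step /=.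
by case: tm_trans => [[[q' a] []]|]; case: r => //= *;
  rewrite addn2 ?ltnS // ltnW // ltnW.
Qed.

Lemma size_right_iter n c :
  size (cf_right (iter n total_step c)) <= size (cf_right c) + n * 2.
Proof.
elim: n => [|n IH] /=; first by rewrite addn0.
rewrite (leq_trans (size_right_total_step _)) // mulSn addnCA addnC.
by rewrite leq_add2l.
Qed.

(** * Reading off the output *)

Local Notation out_form := (list_form -o W_Scott).

Definition emit_branch (a : sym) : term :=
  if a is Bit b then tlam (tlam (consW_term b \@ (tvar 0 \@ tvar 1)))
  else tlam (tlam nilW_term).

Definition emit_term : term := sym_case emit_branch.

(** One unrolling of the recursion of [read_bits]: the outer argument is a reader for the tail. It
    is applied after the case analysis, and only a bit makes use of it. *)
Definition read_term : term :=
  tlam (tlam (tvar 0 \@ emit_term \@ tlam nilW_term \@ tvar 1)).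

Lemma emit_branch_closed a : closed (emit_branch a).
Proof. by case: a => [|[]|]. Qed.

Lemma emit_closed : closed emit_term.
Proof. exact/sym_case_closed/emit_branch_closed. Qed.
#[local] Hint Resolve emit_closed : core.

Lemma emit_ctyped :
  ctyped emit_term (nat_form -o list_form -o out_form -o W_Scott).
Proof.
apply: sym_case_ctyped => // a; apply: ctypedI; first exact: emit_branch_closed.
by case: a => [|[]|k]; rewrite /emit_branch; affs.
Qed.
#[local] Hint Resolve emit_ctyped : ctyped.

Lemma read_closed : closed read_term.
Proof. by rewrite /= !closed_closedn. Qed.
#[local] Hint Resolve read_closed : core.

Lemma read_ctyped : ctyped read_term (out_form -o out_form).
Proof.
apply: ctypedI; first exact: read_closed.
rewrite /read_term; do 2 aff1.
eapply aff_app; [|by affs..].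
by apply: aff_list_case; affs.
Qed.

(** Correctness is bounded by a length, since a reader unrolls finitely many levels of the
    recursion. *)
Definition reads (n : nat) (g : term) : Prop := forall s, size s <= n ->
  red (g \@ enc_list s) (scott (read_bits s)).

Lemma reads_nil : reads 0 (tlam nilW_term).
Proof. by case=> // _; hstep; apply: rt_refl. Qed.

Lemma reads_step n g : closed g -> reads n g -> reads n.+1 (read_term \@ g).
Proof.
move=> cg gn [_|a s sn]; rewrite /read_term; do 2 hstep.
  by do 3 hstep; apply: rt_refl.
do 2 hstep.
apply: red_trans (red_appl _ (red_appl _ (sym_case_red _ emit_branch_closed))) _.
case: a sn => [|[]|k] /= sn; do 2 hstep; try exact: rt_refl.
  exact: red_trans (red_appr _ (gn _ sn)) (consW_red true _).
exact: red_trans (red_appr _ (gn _ sn)) (consW_red false _).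
Qed.

Lemma reads_iter n : reads n (iter n (tapp read_term) (tlam nilW_term)).
Proof.
elim: n => [|n IH]; first exact: reads_nil.
by apply: reads_step => //; apply: closed_iter_app.
Qed.

End Machine.

#[local] Hint Resolve enc_list_closed : core.

(** * Polynomial iteration *)

Lemma church_closed w : closed (church w).
Proof. by rewrite /=; elim: w => //= -[]. Qed.
#[local] Hint Resolve church_closed : core.

Lemma tsubst_word s w a b c :
  tsubst s (foldr (fun i t => tapp (if i then b else a) t) c w) =
  foldr (fun i t => tapp (if i then tsubst s b else tsubst s a) t) (tsubst s c) w.
Proof. by elim: w => //= -[] w ->. Qed.

Lemma church_red w a b x : closed a -> closed b -> closed x ->
  red (church w \@ a \@ b \@ x)
      (foldr (fun i t => tapp (if i then b else a) t) x w).
Proof.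
move=> ca cb cx; rewrite /church.
(* The conditional is moved out of [tvar], so that [tsubst_word] can substitute arbitrary terms for
   the letters. *)
have -> : foldr (fun i t => tvar (if i then 1 else 2) \@ t) (tvar 0) w =
          foldr (fun i t => (if i then tvar 1 else tvar 2) \@ t) (tvar 0) w.
  by elim: w => //= -[] w ->.
do 3 (apply: red_trans (red_head_step _) _;
  rewrite /= /tinst /= tsubst_word /= ?(tren_closed, tsubst_closed) //).
exact: rt_refl.
Qed.

(** * Closed terms depending on the input word *)

Definition const_term (t : term) : term := tlam t.
(** For closed arguments, [const_term], [share_term] and [word_term] play the roles of the
    combinators K, S and I: every term below is a function of the word assembled from them. *)
Definition share_term (t u : term) : term :=
  tlam (t \@ tvar 0 \@ (u \@ tvar 0)).
Definition word_term : term := tlam (tvar 0).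

Lemma const_ctyped t A : ctyped t A -> ctyped (const_term t) (farr W_Church A).
Proof.
case=> ct tA; split; first exact: closed_closedn.
apply: ty_arr_i.
by apply: (ty_weak (G := [::]) (G' := [:: (0, W_Church)])
  (D := [::]) (D' := [::])).
Qed.

Lemma share_closed t u : closed t -> closed u -> closed (share_term t u).
Proof. by move=> ct cu; rewrite /= !closed_closedn. Qed.

(* The two uses of the word are typed with distinct variables, 0 and 1, which
   are then contracted. *)
Lemma share_ctyped t u A B : ctyped t (farr W_Church (farr A B)) ->
  ctyped u (farr W_Church A) -> ctyped (share_term t u) (farr W_Church B).
Proof.
case=> ct tA [cu uA]; split; first exact: share_closed.
apply: ty_arr_i.
have -> : t \@ tvar 0 \@ (u \@ tvar 0) =
    tren (merge_vars 0 1 0) (t \@ tvar 0 \@ (u \@ tvar 1)).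
  by rewrite /= !tren_closed.
apply: ty_contr => //.
apply: (ty_arr_e (G1 := [:: (0, _)]) (G2 := [:: (1, _)])) => //.
  by apply: (ty_arr_e (G1 := [::]) (G2 := [:: (0, _)]) _ tA) => //; apply: ty_ax1.
by apply: (ty_arr_e (G1 := [::]) (G2 := [:: (1, _)]) _ uA) => //; apply: ty_ax1.
Qed.

(** The word stays nonlinear in both operands, whose linear contexts are empty, so contraction
    applies as for [farr]. *)
Lemma share_lolli_ctyped t u L B : ctyped t (farr W_Church (L -o B)) ->
  ctyped u (farr W_Church L) -> ctyped (share_term t u) (farr W_Church B).
Proof.
case=> ct tA [cu uA]; split; first exact: share_closed.
apply: ty_arr_i.
have -> : t \@ tvar 0 \@ (u \@ tvar 0) =
    tren (merge_vars 0 1 0) (t \@ tvar 0 \@ (u \@ tvar 1)).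
  by rewrite /= !tren_closed.
apply: ty_contr => //.
apply: (ty_lolli_e (G1 := [:: (0, _)]) (G2 := [:: (1, _)])
  (D1 := [::]) (D2 := [::])) => //.
  by apply: (ty_arr_e (G1 := [::]) (G2 := [:: (0, _)]) _ tA) => //; apply: ty_ax1.
by apply: (ty_arr_e (G1 := [::]) (G2 := [:: (1, _)]) _ uA) => //; apply: ty_ax1.
Qed.

Lemma word_ctyped L : is_lin L ->
  ctyped word_term (farr W_Church (farr (L -o L) (farr (L -o L) (L -o L)))).
Proof.
move=> linL; split=> //; apply: ty_arr_i.
exact: (ty_all_e linL (ty_ax1 0 (A := W_Church) _)).
Qed.

Lemma const_red t u : closed t -> red (const_term t \@ u) t.
Proof. by move=> ct; hstep; apply: rt_refl. Qed.

Lemma share_red t u w : closed t -> closed u ->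
  red (share_term t u \@ church w) (t \@ church w \@ (u \@ church w)).
Proof. by move=> ct cu; hstep; apply: rt_refl. Qed.

(** * Polynomially long iterations *)

Definition iterates (f : term) (n : nat) (t : term) : Prop :=
  forall x, closed x -> red (t \@ x) (iter n (tapp f) x).

Lemma iterates_red f n t u : red t u -> iterates f n u -> iterates f n t.
Proof. by move=> tu fu x cx; apply: red_trans (red_appl _ tu) (fu _ cx). Qed.

(** Both letters are interpreted by the same [t], so the word matters only through its length. *)
Lemma iterates_church f n t w : closed f -> closed t -> iterates f n t ->
  iterates f (n * size w) (church w \@ t \@ t).
Proof.
move=> cf ct ft x cx; apply: red_trans (church_red _ _ _ _) _ => //.
elim: w => [|b w IH] /=; first by rewrite muln0; apply: rt_refl.
apply: red_trans (red_appr _ IH) _; rewrite if_same mulnS iterD.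
exact/ft/closed_iter_app.
Qed.

Definition comp_term : term := tlam (tlam (tlam (tvar 2 \@ (tvar 1 \@ tvar 0)))).

Lemma comp_ctyped L : is_lin L ->
  ctyped comp_term ((L -o L) -o (L -o L) -o L -o L).
Proof.
move=> linL; apply: ctypedI => //; rewrite /comp_term.
have linLL : is_lin (L -o L) by rewrite /= linL.
by do 3 (apply: aff_lam => //); affs.
Qed.

Lemma iterates_comp f m n t u : closed f -> closed t -> closed u ->
  iterates f m t -> iterates f n u -> iterates f (m + n) (comp_term \@ t \@ u).
Proof.
move=> cf ct cu ft fu x cx; do 3 hstep.
rewrite iterD; apply: red_trans (red_appr _ (fu _ cx)) _.
exact/ft/closed_iter_app.
Qed.

Fixpoint power_term (d : nat) (f : term) : term :=
  if d is e.+1 then comp_term \@ f \@ power_term e f else tlam (tvar 0).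

Fixpoint monomial_term (k : nat) (t : term) : term :=
  if k is j.+1 then
    share_term (share_term word_term (monomial_term j t)) (monomial_term j t)
  else const_term t.

(** The monomial iterator composed with [d] further copies of [f], matching the shape of the time
    bound in [polytime]. *)
Definition poly_term (d k : nat) (f : term) : term :=
  share_term
    (share_term (const_term comp_term) (monomial_term k (power_term d f)))
    (const_term (power_term d f)).

Lemma power_closed d f : closed f -> closed (power_term d f).
Proof. by move=> cf; elim: d => //= d ->; rewrite cf. Qed.

Lemma power_ctyped d f L : is_lin L ->
  ctyped f (L -o L) -> ctyped (power_term d f) (L -o L).
Proof.
move=> linL fL; have cT := comp_ctyped linL; have [cf _] := fL.
elim: d => [|d IH]; first by apply: ctypedI; rewrite /=; affs.
have [cd _] := IH; apply: ctypedI; first by rewrite /= cf cd.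
by rewrite /=; affs.
Qed.

Lemma iterates_power d f : closed f -> iterates f d (power_term d f).
Proof.
move=> cf; elim: d => [|d IH] /=; first by move=> x cx; hstep; apply: rt_refl.
apply: (iterates_comp (m := 1)) => //; first exact: power_closed.
by move=> x cx; apply: rt_refl.
Qed.

Lemma monomial_closed k t : closed t -> closed (monomial_term k t).
Proof.
move=> ct; elim: k => [|k IH] /=; first exact: closed_closedn.
by rewrite !closed_closedn.
Qed.

Lemma monomial_ctyped k t L : is_lin L ->
  ctyped t (L -o L) -> ctyped (monomial_term k t) (farr W_Church (L -o L)).
Proof.
move=> linL tL; elim: k => [|k IH] /=; first exact: const_ctyped.
by apply: (share_ctyped _ IH); apply: (share_ctyped _ IH); apply: word_ctyped.
Qed.

Lemma iterates_monomial k n f t w : closed f -> closed t -> iterates f n t ->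
  iterates f (n * size w ^ k) (monomial_term k t \@ church w).
Proof.
move=> cf ct ft; elim: k => [|k IH].
  by rewrite muln1; apply: iterates_red (const_red _ ct) ft.
have ck := monomial_closed k ct.
have ckw := closed_app ck (church_closed w).
rewrite expnSr mulnA; apply: iterates_red (iterates_church w cf ckw IH).
apply: red_trans (share_red _ _ ck) (red_appl _ _); first exact: share_closed.
apply: red_trans (share_red _ _ ck) (red_appl _ _) => //.
by hstep; apply: rt_refl.
Qed.

Lemma poly_closed d k f : closed f -> closed (poly_term d k f).
Proof.
move=> cf; have cp := power_closed d cf; have cm := monomial_closed k cp.
by rewrite /= !closed_closedn.
Qed.

Lemma poly_ctyped d k f L : is_lin L ->
  ctyped f (L -o L) -> ctyped (poly_term d k f) (farr W_Church (L -o L)).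
Proof.
move=> linL fL; have pL := power_ctyped d linL fL.
apply: share_lolli_ctyped (const_ctyped pL).
apply: share_lolli_ctyped (monomial_ctyped k linL pL).
exact/const_ctyped/comp_ctyped.
Qed.

Lemma iterates_poly d k f w : closed f ->
  iterates f (d * size w ^ k + d) (poly_term d k f \@ church w).
Proof.
move=> cf; have cp := power_closed d cf; have cm := monomial_closed k cp.
have fp := iterates_power d cf.
have cmw := closed_app cm (church_closed w).
apply: iterates_red (iterates_comp cf cmw cp (iterates_monomial k w cf cp fp) fp).
apply: red_trans (share_red _ _ _) (red_app _ (const_red _ cp)).
- by apply: share_closed.
- exact: closed_closedn.
apply: red_trans (share_red _ _ cm) (red_appl _ (const_red _ _)) => //.
Qed.

(** * The simulating term *)

(** Folds the Church word with the list constructors for the two bits, whose codes under [sym_code]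
    are 1 and 2. *)
Definition input_term : term :=
  share_term
    (share_term (share_term word_term (const_term (cons_term \@ enc_nat 1)))
       (const_term (cons_term \@ enc_nat 2)))
    (const_term nil_term).

Lemma input_ctyped : ctyped input_term (farr W_Church list_form).
Proof.
have consT i : ctyped (cons_term \@ enc_nat i) (list_form -o list_form).
  apply: ctypedI; first by rewrite /= enc_nat_closed.
  by affs.
apply: share_lolli_ctyped (const_ctyped nil_ctyped).
apply: share_ctyped (const_ctyped (consT 2)).
apply: share_ctyped (const_ctyped (consT 1)).
exact: word_ctyped.
Qed.

Lemma input_red (M : turing) w :
  red (input_term \@ church w) (@enc_list M [seq Bit b | b <- w]).
Proof.
have cc i : closed (cons_term \@ enc_nat i) by apply: closed_app.
have cK t : closed t -> closed (const_term t) := @closed_closedn 0 t.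
have kc i : red (const_term (cons_term \@ enc_nat i) \@ church w)
    (cons_term \@ enc_nat i) by apply: const_red.
have c1 : closed (share_term word_term (const_term (cons_term \@ enc_nat 1))).
  exact/share_closed/cK.
have c2 := share_closed c1 (cK _ (cc 2)).
apply: red_trans (share_red w c2 (cK nil_term isT)) _.
apply: (red_trans (u := church w \@ (cons_term \@ enc_nat 1)
  \@ (cons_term \@ enc_nat 2) \@ nil_term)).
  apply: red_app (const_red _ _) => //.
  apply: red_trans (share_red w c1 (cK _ (cc 2))) (red_app _ (kc 2)).
  apply: red_trans (share_red w _ (cK _ (cc 1))) (red_app _ (kc 1)) => //.
  by hstep; apply: rt_refl.
apply: red_trans (church_red w (cc 1) (cc 2) _) _ => //.
elim: w {kc} => [|b w IH]; first exact: rt_refl.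
apply: red_trans (red_appr _ IH) _.
by case: b; [apply: (@cons_red M (Bit true))|apply: (@cons_red M (Bit false))].
Qed.

Definition init_term (M : turing) : term :=
  tlam (config_term \@ enc_nat (state_code (tm_start M)) \@ nil_term \@ tvar 0).

Lemma init_closed M : closed (init_term M).
Proof. by rewrite /= !closed_closedn. Qed.

Lemma init_ctyped M : ctyped (init_term M) (list_form -o config_form).
Proof. by apply: ctypedI; rewrite ?init_closed // /init_term; affs. Qed.

Lemma init_red (M : turing) (s : seq (symbol (tm_aux M))) :
  red (init_term M \@ enc_list s) (enc_config (Config (tm_start M) [::] s)).
Proof. by hstep; apply: (config_red _ [::]). Qed.

Definition right_term : term := tlam (tvar 0 \@ tlam (tlam (tlam (tvar 0)))).

Lemma right_ctyped : ctyped right_term (config_form -o list_form).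
Proof.
apply: ctypedI => //; rewrite /right_term; aff1.
by apply: aff_config_case; affs.
Qed.

Lemma right_red M (c : config M) :
  red (right_term \@ enc_config c) (enc_list (cf_right c)).
Proof. by rewrite /enc_config; do 5 hstep; apply: rt_refl. Qed.

(** The left side bounds the right half of the tape after the run, the right side is the depth of
    the reader. The exponent is raised by one so that [n] itself is absorbed even for [k = 0]. *)
Lemma output_bound c k n : n + (c * n ^ k + c) * 2 <=
  (4 * c + 1) * n ^ k.+1 + (4 * c + 1).
Proof.
(* For the empty word [0 ^ k] is 1 when [k = 0], so the left side can reach [4 * c]; the additive
   constant covers it. *)
case: n => [|n].
  have : c * 0 ^ k <= c by case: k => [|k]; rewrite ?muln1 // exp0n // muln0.
  by rewrite [0 ^ k.+1]exp0n // muln0; lia.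
have pk : 0 < n.+1 ^ k by rewrite expn_gt0.
have le_k : c * n.+1 ^ k <= c * n.+1 ^ k.+1
  by rewrite leq_mul2l expnS leq_pmull ?orbT.
have le_n : n.+1 <= n.+1 ^ k.+1 by rewrite expnS leq_pmulr.
by rewrite [(4 * c + 1) * _]mulnDl mul1n -[4 * c * _]mulnA; lia.
Qed.

(** The word is used three times: as the input, as the clock of the run and as the depth of the
    reader. The output starts at the head, so only the right half is read. *)
Definition machine_term (M : turing) (c k : nat) : term :=
  share_term
    (share_term (poly_term (4 * c + 1) k.+1 (read_term M))
       (const_term (tlam nilW_term)))
    (share_term (const_term right_term)
       (share_term (poly_term c k (step_term M))
          (share_term (const_term (init_term M)) input_term))).

Lemma machine_ctyped M c k : ctyped (machine_term M c k) (farr W_Church W_Scott).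
Proof.
apply: (share_lolli_ctyped (L := list_form)).
  apply: share_lolli_ctyped; first exact/poly_ctyped/read_ctyped.
  by apply/const_ctyped/ctypedI => //; affs.
apply: share_lolli_ctyped (const_ctyped right_ctyped) _.
apply: share_lolli_ctyped; first exact/poly_ctyped/step_ctyped.
exact: share_lolli_ctyped (const_ctyped (init_ctyped _)) input_ctyped.
Qed.

Lemma machine_red M c k w u :
  tm_halts_within (c * size w ^ k + c) (tm_init M w) u ->
  red (machine_term M c k \@ church w) (scott u).
Proof.
move=> hu; have cK t : closed t -> closed (const_term t) := @closed_closedn 0 t.
have ci := init_closed M.
have [cI _] := input_ctyped.
have cs := poly_closed c k (step_closed M).
have cr := poly_closed (4 * c + 1) k.+1 (read_closed M).
have c1 := share_closed (cK _ ci) cI.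
have c2 := share_closed cs c1.
have c3 := share_closed (cK right_term isT) c2.
have c4 := share_closed cr (cK (tlam nilW_term) isT).
apply: red_trans (share_red w c4 c3) _.
have red1 : red (share_term (const_term (init_term M)) input_term \@ church w)
    (enc_config (tm_init M w)).
  apply: red_trans (share_red w (cK _ ci) cI) _.
  apply: red_trans (red_app (const_red _ ci) (input_red M w)) _.
  exact: init_red.
set N := c * size w ^ k + c in hu.
pose cN := iter N (@total_step M) (tm_init M w).
have red2 : red (share_term (const_term right_term) (share_term
    (poly_term c k (step_term M))
    (share_term (const_term (init_term M)) input_term)) \@ church w)
    (enc_list (cf_right cN)).
  apply: red_trans (share_red w (cK right_term isT) c2) _.
  apply: red_trans (right_red _); apply: red_app; first exact: const_red.
  apply: red_trans (share_red w cs c1) (red_trans (red_appr _ red1) _).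
  apply: red_trans (iter_step_red _ _).
  exact: (iterates_poly c k w (step_closed M) (enc_config_closed _)).
apply: red_trans (red_app (share_red w cr _) red2) _; first exact: cK.
apply: red_trans (red_appl _ (red_appr _ (const_red _ _))) _ => //.
apply: red_trans (red_appl _ (iterates_poly _ _ _ (read_closed M) _)) _ => //.
(* The output is taken from the configuration after all [N] steps, whether or not the machine halted
   earlier. Its right half has at most [size w + N * 2] cells, which is within the depth of the
   reader. *)
rewrite -(iter_total_step_halts hu (leqnn _)).
apply: reads_iter; apply: leq_trans (output_bound c k (size w)).
by rewrite (leq_trans (size_right_iter _ _)) //= size_map.
Qed.

Theorem theorem2 (f : seq bool -> seq bool) (hf : polytime f) :
  exists t : term,
    dial [::] [::] t (farr W_Church W_Scott) /\
    forall w : seq bool, beta_nf_of (tapp t (church w)) (scott (f w)).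
Proof.
have [M [c [k hM]]] := hf; exists (machine_term M c k); split.
  by have [] := machine_ctyped M c k.
by move=> w; split; [exact/machine_red/hM|exact: scott_normal].
Qed.
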